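(* Let $j\in\{0,\dots,J\}$ and $g_j\in(\mathbb{R}^+)^N$ be fixed. Let $Q_j\in\mathbb{C}^N$ be the signal whose discrete Fourier transform is given by $$\hat Q_j[k]=r_j^k\,\widehat{g_j^2}[k],\qquad \forall k=\left\lfloor\tfrac N2\right\rfloor-N+1,\dots,\left\lfloor\tfrac N2\right\rfloor .$$ For any $f\in\mathbb{C}^N$ satisfying $\hat f[k]=0$ whenever $N/2<k\le N-1$, the following two properties are equivalent: 1. $|f\star\psi_j|=g_j$; 2. $(f\star\psi_j^{low})\,\overline{(f\star\psi_j^{high})}=Q_j$.
   Context: Signals are elements $f=(f[0],\dots,f[N-1])$ of $\mathbb{C}^N$, where $N\ge 1$ is a fixed integer. $\mathbb{R}^+$ denotes the nonnegative reals. The discrete Fourier transform is $\hat f[k]=\sum_{n=0}^{N-1}f[n]e^{-2\pi i kn/N}$ for $k=0,\dots,N-1$, and is extended $N$-periodically to $k\in\mathbb{Z}$ (so negative frequency indices are read modulo $N$). The circular convolution is $f\star g[k]=\sum_{n=0}^{N-1}f[n]g[k-n]$, with indices read modulo $N$. Products, squares, moduli and complex conjugates of signals are taken entrywise. Let $J\geq 0$ be an integer, $a\in\,]1,+\infty[$ a dilation factor, and $\psi:\mathbb{R}\to\mathbb{C}$ a fixed mother wavelet with Fourier transform $\hat\psi$. For $0\le j\le J$, the wavelet $\psi_j\in\mathbb{C}^N$ is defined by $\hat\psi_j[k]=\hat\psi(a^jk)$ for $k=0,\dots,N-1$. Fix $r\in\,]0,1[$ and set $r_j=r^{a^j}$.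 The signals $\psi_j^{low},\psi_j^{high}\in\mathbb{C}^N$ are defined by $\hat\psi_j^{low}[k]=\hat\psi_j[k]\,r_j^k$ and $\hat\psi_j^{high}[k]=\hat\psi_j[k]\,r_j^{-k}$ for $k=0,\dots,N-1$. *)

(* Defs.v *)
From mathcomp Require Import all_boot all_order all_algebra.
From mathcomp Require Import complex.
From mathcomp Require Import all_classical all_reals all_analysis.

Set Implicit Arguments.
Unset Strict Implicit.
Unset Printing Implicit Defensive.

Import Order.TTheory GRing.Theory Num.Theory.
Import numFieldNormedType.Exports.

Local Open Scope classical_set_scope.
Local Open Scope complex_scope.
Local Open Scope ring_scope.

Definition expi (R : realType) (t : R) : R[i] := cos t +i* sin t.

Definition cmeasurable (R : realType) (F : R -> R[i]) : Prop :=
  measurable_fun [set: R] (fun x => complex.Re (F x)) /\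
  measurable_fun [set: R] (fun x => complex.Im (F x)).

Definition cintegrable (R : realType) (F : R -> R[i]) : Prop :=
  (@lebesgue_measure R).-integrable [set: R]
    (fun x => (complex.Re (F x))%:E) /\
  (@lebesgue_measure R).-integrable [set: R]
    (fun x => (complex.Im (F x))%:E).

Definition cintegral (R : realType) (D : set R) (F : R -> R[i]) : R[i] :=
  Rintegral (@lebesgue_measure R) D (fun x => complex.Re (F x)) +i*
  Rintegral (@lebesgue_measure R) D (fun x => complex.Im (F x)).

Definition sqmod (R : realType) (z : R[i]) : R :=
  complex.Re z ^+ 2 + complex.Im z ^+ 2.

Definition fourier_on (R : realType) (D : set R) (psi : R -> R[i]) (w : R) :
    R[i] :=
  cintegral D (fun x => psi x * expi (- (w * x))).

(* [psihat] is the Fourier transform of [psi], either as an absolutely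
   convergent integral (psi in L^1), or, for psi in L^2, as (a representative
   of) the L^2-limit of the transforms of the truncations of psi to [-n, n].
   Other normalizations of the frequency variable or of the integral amount to
   a rescaling of psi. *)
Definition is_fourier_transform (R : realType) (psi psihat : R -> R[i]) :
    Prop :=
  (cintegrable psi /\ forall w, psihat w = fourier_on [set: R] psi w) \/
  [/\ cmeasurable psi,
      cmeasurable psihat,
      (\int[@lebesgue_measure R]_x (sqmod (psi x))%:E < +oo)%E &
      (fun n : nat => (\int[@lebesgue_measure R]_w
         (sqmod (psihat w - fourier_on `[- n%:R, n%:R] psi w))%:E)%E)
        @ \oo --> 0%E].

(* A mother wavelet psi with Fourier transform psihat.  Being a wavelet
   includes having zero mean, written on the Fourier side so that it also makes
   sense for psi in L^2; for psi in L^1, psihat 0 is the integral of psi.  For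
   even N, the frequencies N/2 and -N/2 coincide, and the equivalence fails
   without this condition. *)
Definition mother_wavelet (R : realType) (psi psihat : R -> R[i]) : Prop :=
  is_fourier_transform psi psihat /\ psihat 0 = 0.

Definition dft (R : realType) (N : nat) (f : 'I_N -> R[i]) (k : 'I_N) : R[i] :=
  \sum_(n < N) f n * expi (- (2 * pi * k%:R * n%:R / N%:R)).

(* N-periodic extension to the integers; [k %% N] is the representative of k
   in {0, ..., N-1}, so the default value 0 is not reached when N > 0. *)
Definition per (R : realType) (N : nat) (f : 'I_N -> R[i]) (k : int) : R[i] :=
  if (insub (absz (k %% N)%Z) : option 'I_N) is Some i then f i else 0.

Definition circ_conv (R : realType) (N : nat) (f g : 'I_N -> R[i]) (k : 'I_N) :
    R[i] :=
  \sum_(n < N) f n * per g (k%:Z - n%:Z).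

Definition dilated (R : realType) (r a : R) (j : nat) : R := r `^ (a ^+ j).

(* Main.v *)
Require Import Defs.
From mathcomp Require Import all_boot all_order all_algebra.
From mathcomp Require Import complex zify ring lra.
From mathcomp Require Import all_classical all_reals all_analysis.

Set Implicit Arguments.
Unset Strict Implicit.
Unset Printing Implicit Defensive.

Import Order.TTheory GRing.Theory Num.Theory.

Local Open Scope complex_scope.
Local Open Scope ring_scope.

(* Put h = f * psi_j. Its spectrum lives in {1, ..., N/2}: frequency 0 is killed
   by the zero mean of the wavelet, those above N/2 by the assumption on f. The
   frequency k of (f * psi_low) conj (f * psi_high) collects the products of the
   frequencies l and m of h with l - m = k mod N, weighted by r_j^l r_j^(-m).
   Because of the support this forces l - m = k, so the weight is r_j^k and the
   spectrum is that of |h|^2 multiplied by r_j^k, just as Q_j is obtained from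
   g_j^2. Since r_j^k is nonzero and the DFT is injective, the two properties
   are equivalent. *)

(** * Complex exponential on the unit circle *)

Section Expi.
Variable R : realType.
Implicit Types x y : R.

Lemma expi0 : expi (0 : R) = 1.
Proof. by rewrite /expi cos0 sin0. Qed.

Lemma expiD x y : expi (x + y) = expi x * expi y.
Proof. by rewrite /expi cosD sinD; simpc; congr (_ +i* _); rewrite addrC. Qed.

Lemma expiN_conj x : expi (- x) = Num.conj (expi x).
Proof. by rewrite /expi cosN sinN. Qed.

Lemma expi_neq0 x : expi x != 0.
Proof.
by apply/eqP => x0; have := expi0; rewrite -(subrr x) expiD x0 mul0r => /eqP;
  rewrite eq_sym oner_eq0.
Qed.

Lemma expiN x : expi (- x) = (expi x)^-1.
Proof.
by apply: (mulfI (expi_neq0 x)); rewrite -expiD subrr expi0 divff ?expi_neq0.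
Qed.

Lemma expiMn x n : expi (x * n%:R) = expi x ^+ n.
Proof.
elim: n => [|n IHn]; first by rewrite mulr0 expi0.
by rewrite -natr1 mulrDr mulr1 expiD IHn exprSr.
Qed.

Lemma expi2pi : expi (2 * pi : R) = 1.
Proof. by rewrite mulr_natl /expi cos2pi sin2pi. Qed.

(** By the half-angle formula [cos x = 1 - 2 * sin (x / 2) ^+ 2], and [sin (x / 2)] is positive when
    [0 < x < 2 * pi]. *)
Lemma expi_eq1 x : 0 <= x < 2 * pi -> expi x = 1 -> x = 0.
Proof.
move=> /andP[x0 x2pi] [cx1 _]; apply/eqP; rewrite eq_le x0 andbT leNgt.
apply/negP => xgt0.
have s_gt0 : 0 < sin (x / 2).
  by apply: sin_gt0_pi; apply/andP; split; lra.
have : cos ((x / 2) *+ 2) = 1 by rewrite -mulr_natr divfK.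
have := cos2Dsin2 (x / 2); rewrite cos_mulr2n; nra.
Qed.

End Expi.

(** * Discrete Fourier analysis on the integers modulo [N] *)

Section Fourier.
Variables (R : realType) (N : nat).
Hypothesis N_gt0 : (0 < N)%N.
Implicit Types (f g : 'I_N -> R[i]).

Lemma modz_ordP (k : int) : {i : 'I_N | (k = i %[mod N])%Z}.
Proof.
have lt : (absz (k %% N)%Z < N)%N by lia.
by exists (Ordinal lt) => /=; rewrite gez0_abs ?modz_mod ?modz_ge0; lia.
Qed.

Lemma perE f (k : int) (i : 'I_N) : (k = i %[mod N])%Z -> per f k = f i.
Proof.
move=> ki; rewrite /per ki modz_nat modn_small // absz_nat.
by case: insubP => [j _ /val_inj ->|]; rewrite // ltn_ord.
Qed.

Lemma per_ord f (i : 'I_N) : per f i = f i.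
Proof. exact: perE. Qed.

(** A primitive [N]-th root of unity. Its integer powers absorb negative frequencies and reduction
    modulo [N]. *)
Definition zeta : R[i] := expi (2 * pi / N%:R).

Lemma zeta_neq0 : zeta != 0.
Proof. exact: expi_neq0. Qed.

Lemma zetaXN : zeta ^+ N = 1.
Proof. by rewrite -expiMn divfK ?expi2pi // pnatr_eq0 -lt0n. Qed.

Lemma zeta_mod (m n : int) : (m = n %[mod N])%Z -> zeta ^ m = zeta ^ n.
Proof.
have red k : zeta ^ k = zeta ^ (k %% N)%Z.
  rewrite {1}(divz_eq k N) expfzDr ?zeta_neq0 // mulrC (mulrC _ N%:Z).
  by rewrite -exprz_exp -exprnP zetaXN exp1rz mulr1.
by move=> e; rewrite red e -red.
Qed.

(** Primitivity: once [m] is reduced to some [i < N], the angle [2 * pi * i / N] lies in the range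
    of [expi_eq1]. *)
Lemma zeta_eq1 (m : int) : (zeta ^ m == 1) = (N %| m)%Z.
Proof.
apply/eqP/idP => [|/dvdz_mod0P m0]; last first.
  by rewrite -[1](expr0z zeta); apply: zeta_mod; rewrite m0 mod0z.
have [i mi] := modz_ordP m.
rewrite (zeta_mod mi) -exprnP -expiMn => /expi_eq1 e.
apply/dvdz_mod0P; rewrite mi.
have Nr0 : 0 < N%:R :> R by rewrite ltr0n.
have pi0 := pi_gt0 R.
have := e; rewrite mulrAC divr_ge0 ?mulr_ge0 ?ler0n ?(ltW pi0) //=.
rewrite ltr_pdivrMr // ltr_pM2l ?mulr_gt0 // ltr_nat ltn_ord => /(_ isT)/eqP.
rewrite !mulf_eq0 invr_eq0 !pnatr_eq0 (gt_eqF pi0) (gtn_eqF N_gt0) /= orbF.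
by move=> /eqP ->; rewrite mod0z.
Qed.

(** Orthogonality of characters. If [N] does not divide [m], multiplying the geometric sum by
    [zeta ^ m - 1], which is nonzero, gives [zeta ^ (m * N) - 1 = 0]. *)
Lemma sum_zeta (m : int) :
  \sum_(l < N) zeta ^ (l%:Z * m) = (N%:R : R[i]) *+ (N %| m)%Z.
Proof.
rewrite (eq_bigr (fun l : 'I_N => (zeta ^ m) ^+ l)); last first.
  by move=> l _; rewrite exprnP exprz_exp mulrC.
have [|ndvd] := boolP (N %| m)%Z.
  rewrite -zeta_eq1 => /eqP ->.
  by rewrite (eq_bigr (fun=> 1)) ?sumr_const ?card_ord // => l _; rewrite expr1n.
have nz : zeta ^ m - 1 != 0 by rewrite subr_eq0 zeta_eq1.
apply: (mulfI nz); rewrite -subrX1 mulr0 exprnP exprz_exp mulrC -exprz_exp.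
by rewrite -exprnP zetaXN exp1rz subrr.
Qed.

Lemma dftE f (k : int) :
  per (dft f) k = \sum_(n < N) f n * zeta ^ (- (k * n)).
Proof.
have [i ki] := modz_ordP k; rewrite (perE _ ki); apply: eq_bigr => n _.
congr (_ * _); transitivity (zeta ^ (- (i%:Z * n%:Z))).
  rewrite expiN -invr_expz -PoszM -exprnP -expiMn natrM; congr (expi _)^-1.
  by field; rewrite pnatr_eq0 -lt0n.
apply: zeta_mod; apply/eqP; rewrite eqz_mod_dvd.
have -> : - (i%:Z * n%:Z) - - (k * n) = (k - i%:Z) * n%:Z by ring.
by rewrite dvdz_mulr // -eqz_mod_dvd; apply/eqP.
Qed.

Lemma dft_ordE f (k : 'I_N) : dft f k = \sum_(n < N) f n * zeta ^ (- (k%:Z * n)).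
Proof. by rewrite -dftE per_ord. Qed.

Lemma natN_neq0 : (N%:R : R[i]) != 0.
Proof. by rewrite pnatr_eq0 -lt0n. Qed.

Lemma dft_inversion f (k : int) :
  per f k = N%:R^-1 * \sum_(l < N) dft f l * zeta ^ (l%:Z * k).
Proof.
apply: (mulfI natN_neq0); rewrite mulrA divff ?natN_neq0 // mul1r.
have [i ki] := modz_ordP k; rewrite (perE _ ki).
transitivity (\sum_(n < N) f n * \sum_(l < N) zeta ^ (l%:Z * (k - n%:Z))).
  rewrite (bigD1 i) //= [X in _ + X]big1 => [|n ni]; rewrite sum_zeta.
    by rewrite -eqz_mod_dvd ki eqxx mulr1n addr0 mulrC.
  rewrite -eqz_mod_dvd ki !modz_nat !modn_small // eqz_nat eq_sym.
  by rewrite (negPf (_ : val n != val i)) ?mulr0.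
under eq_bigr do rewrite mulr_sumr.
rewrite exchange_big; apply: eq_bigr => l _; rewrite dft_ordE mulr_suml.
apply: eq_bigr => n _; rewrite -mulrA -expfzDr ?zeta_neq0 //.
by congr (_ * _ ^ _); ring.
Qed.

Lemma dft_inj f g : dft f =1 dft g -> f =1 g.
Proof.
move=> fg i; rewrite -(per_ord f) -(per_ord g) !dft_inversion.
by congr (_ * _); apply: eq_bigr => l _; rewrite fg.
Qed.

(** The convolution theorem, read after Fourier inversion: expanding [g] by inversion leaves a sum
    over [m] that is the transform of [f]. *)
Lemma circ_conv_inversion f g (n : 'I_N) :
  circ_conv f g n =
    N%:R^-1 * \sum_(l < N) dft f l * dft g l * zeta ^ (l%:Z * n).
Proof.
rewrite /circ_conv; under eq_bigr => m _ do
  rewrite dft_inversion mulrCA mulr_sumr.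
rewrite -mulr_sumr exchange_big; congr (_ * _); apply: eq_bigr => l _.
rewrite [dft f l]dft_ordE !mulr_suml; apply: eq_bigr => m _.
have -> : l%:Z * (n%:Z - m%:Z) = - (l%:Z * m) + l%:Z * n by ring.
by rewrite expfzDr ?zeta_neq0 //; ring.
Qed.

Lemma conj_zeta (m : int) : Num.conj (zeta ^ m) = zeta ^ (- m).
Proof. by rewrite -exprz_inv -expiN expiN_conj fmorphXz. Qed.

(** Summing over [n] keeps, by orthogonality, only the pairs with [l - m = k] modulo [N]. The
    coefficients [A] and [B] are free, so that the expansions of convolutions fit directly. *)
Lemma dft_mul_conj (u v A B : 'I_N -> R[i]) (k : int) :
    (forall n, u n = N%:R^-1 * \sum_(l < N) A l * zeta ^ (l%:Z * n)) ->
    (forall n, v n = N%:R^-1 * \sum_(m < N) B m * zeta ^ (m%:Z * n)) ->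
  per (dft (fun n => u n * Num.conj (v n))) k =
    N%:R^-1 * \sum_(l < N) \sum_(m < N)
      (A l * Num.conj (B m)) *+ (N %| l%:Z - m%:Z - k)%Z.
Proof.
move=> hu hv; rewrite dftE.
transitivity (N%:R^-1 * N%:R^-1 * \sum_(l < N) \sum_(m < N)
    A l * Num.conj (B m) * \sum_(n < N) zeta ^ (n%:Z * (l%:Z - m%:Z - k))).
  rewrite mulr_sumr.
  under [RHS]eq_bigr => l _.
    rewrite mulr_sumr.
    under eq_bigr do rewrite !mulr_sumr.
    rewrite exchange_big.
    over.
  rewrite exchange_big; apply: eq_bigr => n _ /=.
  rewrite hu hv rmorphM fmorphV rmorph_nat rmorph_sum /=.
  rewrite mulrACA big_distrlr /= -[LHS]mulrA mulr_suml mulr_sumr.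
  apply: eq_bigr => l _; rewrite mulr_suml mulr_sumr; apply: eq_bigr => m _.
  rewrite rmorphM /= conj_zeta.
  have -> : n%:Z * (l%:Z - m%:Z - k) = l%:Z * n + - (m%:Z * n) + - (k * n) by ring.
  by rewrite !expfzDr ?zeta_neq0 //; ring.
(* The inner sum is [N] or [0]; this [N] cancels one of the two normalizing factors. *)
rewrite -mulrA; congr (_ * _); rewrite mulr_sumr; apply: eq_bigr => l _.
rewrite mulr_sumr; apply: eq_bigr => m _; rewrite sum_zeta.
case: dvdz_mod0P => _; last by rewrite !mulr0.
by rewrite mulrCA mulVf ?natN_neq0 // mulr1.
Qed.

End Fourier.

(** * Rescaled spectra and the equivalence *)

(* For [l], [m] in the support and [k] in the window, [l - m - k] has absolute
   value less than [N]: it is a multiple of [N] only if [k = l - m], in which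
   case [s ^ l * s ^ (- m) = s ^ k]. *)
Lemma dft_rescaled_mul_conj (R : realType) (N : nat) (s : R)
    (h u v : 'I_N -> R[i]) (H : 'I_N -> R[i]) (k : int) :
    (0 < N)%N -> s != 0 ->
    (forall l : 'I_N, H l != 0 -> (0 < l <= N %/ 2)%N) ->
    (forall n, h n = N%:R^-1 * \sum_(l < N) H l * zeta R N ^ (l%:Z * n)) ->
    (forall n, u n =
      N%:R^-1 * \sum_(l < N) (H l * (s ^+ l)%:C) * zeta R N ^ (l%:Z * n)) ->
    (forall n, v n =
      N%:R^-1 * \sum_(l < N) (H l * (s ^- l)%:C) * zeta R N ^ (l%:Z * n)) ->
    (N %/ 2)%N%:Z - N%:Z + 1 <= k <= (N %/ 2)%N%:Z ->
  per (dft (fun n => u n * Num.conj (v n))) k =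
    (s ^ k)%:C * per (dft (fun n => h n * Num.conj (h n))) k.
Proof.
move=> N0 s0 supp hE uE vE kN.
rewrite (dft_mul_conj N0 k uE vE) (dft_mul_conj N0 k hE hE).
rewrite mulrCA; congr (_ * _); rewrite mulr_sumr; apply: eq_bigr => l _.
rewrite mulr_sumr; apply: eq_bigr => m _.
have [->|/supp lN] := eqVneq (H l) 0; first by rewrite !mul0r mul0rn mulr0.
have [->|/supp mN] := eqVneq (H m) 0.
  by rewrite mul0r rmorph0 !mulr0 mul0rn mulr0.
case: dvdzP => [[q qE]|_]; last by rewrite mulr0.
(* Positivity of [l] matters: for even [N], the choice [l = 0], [m = k = N / 2] would give
   [q = -1]. *)
have q0 : q = 0 by nia.
have {q0 qE} kE : k = l%:Z + - m%:Z by lia.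
rewrite kE expfzDr // -exprnP -exprnN !rmorphM /= !mulr1n.
by rewrite (conj_Creal (_ : (s ^- m)%:C \is Num.real)) ?complex_real //; ring.
Qed.

(** The window consists of [N] consecutive integers, hence meets every residue class modulo [N]. *)
Lemma dft_window_inj (R : realType) (N : nat) (u v : 'I_N -> R[i]) :
    (0 < N)%N ->
    (forall k : int, (N %/ 2)%N%:Z - N%:Z + 1 <= k <= (N %/ 2)%N%:Z ->
      per (dft u) k = per (dft v) k) ->
  u =1 v.
Proof.
move=> N0 uv; apply: dft_inj => // i.
(* Frequencies above [N / 2] enter the window after a shift by [-N]. *)
pose k : int := if (i <= N %/ 2)%N then i%:Z else i%:Z - N%:Z.
have ki : (k = i %[mod N])%Z.
  rewrite /k; case: ifP => // _; apply/eqP.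
  by rewrite eqz_mod_dvd addrAC subrr add0r dvdzE abszN.
rewrite -(perE _ ki) -(perE (dft v) ki) uv //.
have := ltn_ord i; rewrite /k; case: ifP; lia.
Qed.

(** Squaring loses nothing between nonnegative reals; it turns the modulus condition into a product
    with a known spectrum. *)
Lemma normc_eqE (R : realType) (z : R[i]) (x : R) : 0 <= x ->
  `|z| = x%:C <-> z * Num.conj z = (x ^+ 2)%:C.
Proof.
move=> x0; rewrite -normCK rmorphXn /=; split=> [-> //|/eqP].
by rewrite eqrXn2 ?normr_ge0 ?ler0c // => /eqP.
Qed.

Theorem mainTheorem1 (R : realType) (N J : nat) (hN : (1 <= N)%N)
    (a : R) (ha : 1 < a)
    (psi psihat : R -> R[i]) (hpsi : mother_wavelet psi psihat)
    (r : R) (hr0 : 0 < r) (hr1 : r < 1)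
    (j : nat) (hj : (j <= J)%N)
    (psij psij_low psij_high : 'I_N -> R[i])
    (hpsij : forall k : 'I_N, dft psij k = psihat (a ^+ j * k%:R))
    (hpsij_low : forall k : 'I_N,
       dft psij_low k = dft psij k * (dilated r a j ^+ k)%:C)
    (hpsij_high : forall k : 'I_N,
       dft psij_high k = dft psij k * (dilated r a j ^- k)%:C)
    (gj : 'I_N -> R) (hgj : forall n : 'I_N, 0 <= gj n)
    (Qj : 'I_N -> R[i])
    (hQj : forall k : int,
       (N %/ 2)%N%:Z - N%:Z + 1 <= k <= (N %/ 2)%N%:Z ->
       per (dft Qj) k =
         (dilated r a j ^ k)%:C * per (dft (fun n => (gj n ^+ 2)%:C)) k)
    (f : 'I_N -> R[i])
    (hf : forall k : 'I_N, N%:R / 2 < k%:R :> R -> dft f k = 0) :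
  (forall n : 'I_N, `|circ_conv f psij n| = (gj n)%:C)
  <->
  (forall n : 'I_N, circ_conv f psij_low n * Num.conj (circ_conv f psij_high n) = Qj n).
Proof.
have s_gt0 : 0 < dilated r a j by exact: powR_gt0.
set s := dilated r a j in hpsij_low hpsij_high hQj s_gt0 *.
have s0 : s != 0 by rewrite gt_eqF.
pose H l := dft f l * dft psij l.
have supp l : H l != 0 -> (0 < l <= N %/ 2)%N.
  rewrite /H mulf_eq0 negb_or => /andP[fl psil]; apply/andP; split.
    rewrite lt0n; apply: contraNneq psil => l0.
    by rewrite hpsij l0 mulr0 hpsi.2.
  rewrite leqNgt; apply: contraNN fl => Nl; apply/eqP/hf.
  by rewrite ltr_pdivrMr // -natrM ltr_nat; lia.
have hE n : circ_conv f psij n =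
    N%:R^-1 * \sum_(l < N) H l * zeta R N ^ (l%:Z * n).
  exact: circ_conv_inversion.
have uE n : circ_conv f psij_low n =
    N%:R^-1 * \sum_(l < N) (H l * (s ^+ l)%:C) * zeta R N ^ (l%:Z * n).
  rewrite circ_conv_inversion //; congr (_ * _); apply: eq_bigr => l _.
  by rewrite hpsij_low /H mulrA.
have vE n : circ_conv f psij_high n =
    N%:R^-1 * \sum_(l < N) (H l * (s ^- l)%:C) * zeta R N ^ (l%:Z * n).
  rewrite circ_conv_inversion //; congr (_ * _); apply: eq_bigr => l _.
  by rewrite hpsij_high /H mulrA.
have key k := dft_rescaled_mul_conj (k := k) hN s0 supp hE uE vE.
have per_ext (F G : 'I_N -> R[i]) k : F =1 G -> per (dft F) k = per (dft G) k.
  by move=> FG; rewrite !dftE //; apply: eq_bigr => n _; rewrite FG.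
split=> [hg n|lowhigh n].
  move: n; apply: dft_window_inj => // k kN.
  rewrite key // hQj //; congr (_ * _); apply: per_ext => n.
  exact/normc_eqE.
apply/normc_eqE => //; move: n; apply: dft_window_inj => // k kN.
(* Both spectra carry the same factor [s ^ k], which cancels to leave those of the squared modulus
   and of [gj ^+ 2]. *)
have sk : (s ^ k)%:C != 0 :> R[i] by rewrite fmorph_eq0 expfz_neq0.
apply: (mulfI sk); rewrite -key // -hQj //; exact: per_ext.
Qed.
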